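(* Let $a,b>0$, let $n\in\mathbb{N}$ with $n\ge2$, and let $v\in\mathbb{R}$ with $v\ne\frac12$. (i) If $v\notin\left[\frac12,\frac{2^{n-1}+1}{2^n}\right]$, then $$\frac{a+b}2\le H_v(a,b)+(1-v)\left(\sqrt a-\sqrt b\right)^2+\left(v-\frac12\right)\sqrt{ab}\sum_{k=2}^n2^{k-2}\left\{\left(\sqrt[2^k]{\frac ab}-1\right)^2+\left(\sqrt[2^k]{\frac ba}-1\right)^2\right\}.$$ (ii) If $v\notin\left[\frac{2^{n-1}-1}{2^n},\frac12\right]$, then $$\frac{a+b}2\le H_v(a,b)+v\left(\sqrt a-\sqrt b\right)^2+\left(\frac12-v\right)\sqrt{ab}\sum_{k=2}^n2^{k-2}\left\{\left(\sqrt[2^k]{\frac ab}-1\right)^2+\left(\sqrt[2^k]{\frac ba}-1\right)^2\right\}.$$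
   Context: For $a,b>0$ and $v\in\mathbb{R}$, $H_v(a,b)=\dfrac{a^{1-v}b^v+a^vb^{1-v}}{2}$. All powers and roots are the usual real ones of positive real numbers; $\sqrt[m]{x}=x^{1/m}$. *)

(* Defs.v *)
From Stdlib Require Import Reals.
Open Scope R_scope.

(** [Rpower x y] is [exp (y * ln x)], the real power of a positive [x]; it is
    only ever applied to positive bases below. *)

Definition Heinz (v a b : R) : R :=
  (Rpower a (1 - v) * Rpower b v + Rpower a v * Rpower b (1 - v)) / 2.

Definition nroot (m : nat) (x : R) : R := Rpower x (1 / INR m).

(** [sum_f 2 n f] is [f 2 + ... + f n] for [2 <= n]; the truncated
    exponent [k - 2] is harmless as only [k >= 2] occurs. *)
Definition root_sum (n : nat) (a b : R) : R :=
  sum_f 2 n (fun k : nat =>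
    2 ^ (k - 2) *
      ((nroot (2 ^ k)%nat (a / b) - 1) ^ 2 +
       (nroot (2 ^ k)%nat (b / a) - 1) ^ 2)).

(* Main.v *)
Require Import Defs.
From Stdlib Require Import Reals Lra Lia.
Open Scope R_scope.

(** Both sides are homogeneous in [(a, b)], so everything is governed by
    [x = ln (a / b)]: after division by [sqrt (a * b)] the arithmetic mean
    becomes [cosh (x / 2)], the Heinz mean [cosh ((2 * v - 1) * (x / 2))], and
    [(sqrt a - sqrt b) ^ 2] becomes [2 * (cosh (x / 2) - 1)].

    With [D k = 2 ^ k * (cosh (x / 2 ^ k) - 1)], the [k]-th term of the root sum
    is [D (k - 1) - D k] ([root_term_cosh]), because
    [(e^s - 1)^2 + (e^-s - 1)^2 = 2 (cosh (2 s) - 1) - 4 (cosh s - 1)].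
    Hence the root sum telescopes to [D 1 - D n] ([root_sum_telescopes]).  Since
    [D 1 = 2 * (cosh (x / 2) - 1)], the coefficients [1 - v] and [v - 1 / 2]
    of [D 1] add up to [1 / 2]; this cancels the arithmetic mean except for the
    constant [1], and what is left of the first inequality is
    [p * (cosh u - 1) <= cosh (p * u) - 1] with [u = x / 2 ^ n] and
    [p = (2 * v - 1) * 2 ^ (n - 1)].  The excluded interval for [v] is exactly
    [0 <= p <= 1], and outside [[0, 1]] this is a Bernoulli-type consequence of
    the convexity of [cosh] ([cosh_bernoulli]).

    The second inequality is the first one at [1 - v], the Heinz mean being
    invariant under [v -> 1 - v]. *)

(** Both exponentials in [cosh] lie above their tangents at [x]. *)
Lemma cosh_above_tangent (x y : R) :
  cosh x + (y - x) * sinh x <= cosh y.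
Proof.
  unfold cosh, sinh.
  replace (exp y) with (exp x * exp (y - x))
    by (rewrite <- exp_plus; f_equal; ring).
  replace (exp (- y)) with (exp (- x) * exp (- (y - x)))
    by (rewrite <- exp_plus; f_equal; ring).
  pose proof (exp_pos x). pose proof (exp_pos (- x)).
  pose proof (exp_ineq1_le (y - x)). pose proof (exp_ineq1_le (- (y - x))).
  nra.
Qed.

Lemma cosh_ge_1 (x : R) : 1 <= cosh x.
Proof.
  pose proof (cosh_above_tangent 0 x) as H.
  rewrite cosh_0, sinh_0 in H. lra.
Qed.

(** The analogue of Bernoulli's inequality.  For [p < 0] zero
    separates the two sides; for [1 < p], [u] lies between [0] and [p * u] and convexity
    applies. *)
Lemma cosh_bernoulli (p u : R) (hp : ~ (0 <= p <= 1)) :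
  p * (cosh u - 1) <= cosh (p * u) - 1.
Proof.
  destruct (Rlt_le_dec p 0) as [hneg | hpos].
  - pose proof (cosh_ge_1 u). pose proof (cosh_ge_1 (p * u)). nra.
  - assert (1 < p) by lra.
    (* The tangent at [u], evaluated at [p * u] and at [0]; the combination with
       weights [1] and [p - 1] eliminates the slope. *)
    pose proof (cosh_above_tangent u (p * u)) as H1.
    pose proof (cosh_above_tangent u 0) as H0.
    rewrite cosh_0 in H0. nra.
Qed.

Lemma ln_div (a b : R) (ha : 0 < a) (hb : 0 < b) :
  ln (a / b) = ln a - ln b.
Proof.
  unfold Rdiv. rewrite ln_mult, ln_Rinv by auto using Rinv_0_lt_compat. ring.
Qed.

Lemma nroot_pow2 (k : nat) (x : R) :
  nroot (2 ^ k) x = exp (ln x / 2 ^ k).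
Proof.
  unfold nroot, Rpower. rewrite pow_INR. f_equal.
  change (INR 2) with 2. field. apply pow_nonzero; lra.
Qed.

Lemma root_pair_cosh (s : R) :
  (exp s - 1) ^ 2 + (exp (- s) - 1) ^ 2
  = 2 * (cosh (2 * s) - 1) - 4 * (cosh s - 1).
Proof.
  unfold cosh.
  replace (2 * s) with (s + s) by ring.
  replace (- (s + s)) with (- s + - s) by ring.
  rewrite !exp_plus. field.
Qed.

(** The index is shifted by [2] to match the start of the sum. *)
Lemma root_term_cosh (j : nat) (a b : R) (ha : 0 < a) (hb : 0 < b) :
  2 ^ j * ((nroot (2 ^ (j + 2)) (a / b) - 1) ^ 2
           + (nroot (2 ^ (j + 2)) (b / a) - 1) ^ 2)
  = 2 ^ (j + 1) * (cosh (ln (a / b) / 2 ^ (j + 1)) - 1)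
    - 2 ^ (j + 2) * (cosh (ln (a / b) / 2 ^ (j + 2)) - 1).
Proof.
  assert (h2 : 2 ^ j <> 0) by (apply pow_nonzero; lra).
  rewrite !nroot_pow2.
  replace (ln (b / a) / 2 ^ (j + 2)) with (- (ln (a / b) / 2 ^ (j + 2)))
    by (rewrite !ln_div, pow_add by assumption; field; assumption).
  rewrite root_pair_cosh.
  replace (2 * (ln (a / b) / 2 ^ (j + 2))) with (ln (a / b) / 2 ^ (j + 1))
    by (rewrite !pow_add; field; assumption).
  rewrite !pow_add. ring.
Qed.

Lemma root_sum_telescopes (n : nat) (hn : (2 <= n)%nat)
  (a b : R) (ha : 0 < a) (hb : 0 < b) :
  root_sum n a b
  = 2 * (cosh (ln (a / b) / 2) - 1)
    - 2 ^ n * (cosh (ln (a / b) / 2 ^ n) - 1).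
Proof.
  replace n with ((n - 2) + 2)%nat by lia.
  generalize (n - 2)%nat as m; clear n hn.
  unfold root_sum, sum_f.
  intro m. replace (m + 2 - 2)%nat with m by lia.
  induction m as [| m IH]; cbn [sum_f_R0].
  - change (0 + 2 - 2)%nat with 0%nat.
    rewrite root_term_cosh by assumption.
    change (0 + 1)%nat with 1%nat. rewrite pow_1. ring.
  - rewrite IH. replace (S m + 2 - 2)%nat with (S m) by lia.
    rewrite root_term_cosh by assumption.
    replace (S m + 1)%nat with (m + 2)%nat by lia. ring.
Qed.

Lemma sqrt_exp_ln (a : R) (ha : 0 < a) : sqrt a = exp (ln a / 2).
Proof.
  rewrite <- Rpower_sqrt by assumption. unfold Rpower. f_equal. field.
Qed.

Lemma Heinz_cosh (v a b : R) (ha : 0 < a) (hb : 0 < b) :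
  Heinz v a b
  = sqrt (a * b) * cosh ((2 * v - 1) * (ln (a / b) / 2)).
Proof.
  rewrite sqrt_exp_ln, ln_mult, ln_div by auto using Rmult_lt_0_compat.
  unfold Heinz, Rpower, cosh.
  set (m := (ln a + ln b) / 2).
  set (w := (2 * v - 1) * ((ln a - ln b) / 2)).
  replace (exp m * ((exp w + exp (- w)) / 2))
    with ((exp m * exp (- w) + exp m * exp w) / 2) by field.
  rewrite <- !exp_plus. unfold m, w.
  f_equal; f_equal; f_equal; field.
Qed.

Lemma Heinz_sym (v a b : R) : Heinz (1 - v) a b = Heinz v a b.
Proof.
  unfold Heinz. replace (1 - (1 - v)) with v by ring. field.
Qed.

(** The arithmetic mean is the Heinz mean at [v = 1]. *)
Lemma arith_mean_cosh (a b : R) (ha : 0 < a) (hb : 0 < b) :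
  (a + b) / 2 = sqrt (a * b) * cosh (ln (a / b) / 2).
Proof.
  pose proof (Heinz_cosh 1 a b ha hb) as H.
  replace ((2 * 1 - 1) * (ln (a / b) / 2)) with (ln (a / b) / 2) in H by field.
  rewrite <- H. unfold Heinz. replace (1 - 1) with 0 by ring.
  rewrite !Rpower_O, !Rpower_1 by assumption. field.
Qed.

Lemma sqrt_diff_sq_cosh (a b : R) (ha : 0 < a) (hb : 0 < b) :
  (sqrt a - sqrt b) ^ 2 = 2 * sqrt (a * b) * (cosh (ln (a / b) / 2) - 1).
Proof.
  pose proof (arith_mean_cosh a b ha hb) as Hm.
  pose proof (sqrt_mult a b (Rlt_le _ _ ha) (Rlt_le _ _ hb)) as Hg.
  pose proof (sqrt_sqrt a (Rlt_le _ _ ha)).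
  pose proof (sqrt_sqrt b (Rlt_le _ _ hb)).
  nra.
Qed.

Lemma arith_mean_le_refined_Heinz (a b : R) (ha : 0 < a) (hb : 0 < b)
  (n : nat) (hn : (2 <= n)%nat) (v : R)
  (hv : ~ (1 / 2 <= v <= (2 ^ (n - 1) + 1) / 2 ^ n)) :
  (a + b) / 2 <=
    Heinz v a b + (1 - v) * (sqrt a - sqrt b) ^ 2
    + (v - 1 / 2) * sqrt (a * b) * root_sum n a b.
Proof.
  rewrite root_sum_telescopes, sqrt_diff_sq_cosh, Heinz_cosh, arith_mean_cosh
    by assumption.
  assert (hg : 0 < sqrt (a * b)) by (apply sqrt_lt_R0; nra).
  assert (hN : 0 < 2 ^ (n - 1)) by (apply pow_lt; lra).
  assert (h2n : 2 ^ n = 2 * 2 ^ (n - 1))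
    by (replace n with (S (n - 1)) at 1 by lia; reflexivity).
  rewrite h2n in *.
  set (N := 2 ^ (n - 1)) in *.
  set (x := ln (a / b)).
  assert (hp : ~ (0 <= (2 * v - 1) * N <= 1)).
  { intros [h0 h1]. apply hv. split.
    - nra.
    - apply Rmult_le_reg_r with (2 * N); [lra |].
      unfold Rdiv. rewrite Rmult_assoc, Rinv_l by lra. lra. }
  pose proof (cosh_bernoulli _ (x / (2 * N)) hp) as H.
  replace ((2 * v - 1) * N * (x / (2 * N)))
    with ((2 * v - 1) * (x / 2)) in H by (field; lra).
  apply (Rmult_le_compat_l (sqrt (a * b))) in H; [| lra].
  lra.
Qed.

Theorem corollary4 (a b : R) (ha : 0 < a) (hb : 0 < b)
  (n : nat) (hn : (2 <= n)%nat) (v : R) (hv : v <> 1 / 2) :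
  (~ (1 / 2 <= v <= (2 ^ (n - 1) + 1) / 2 ^ n) ->
     (a + b) / 2 <=
       Heinz v a b + (1 - v) * (sqrt a - sqrt b) ^ 2
       + (v - 1 / 2) * sqrt (a * b) * root_sum n a b)
  /\
  (~ ((2 ^ (n - 1) - 1) / 2 ^ n <= v <= 1 / 2) ->
     (a + b) / 2 <=
       Heinz v a b + v * (sqrt a - sqrt b) ^ 2
       + (1 / 2 - v) * sqrt (a * b) * root_sum n a b).
Proof.
  split; intro hout.
  - apply arith_mean_le_refined_Heinz; assumption.
  - rewrite <- (Heinz_sym v).
    replace (1 / 2 - v) with ((1 - v) - 1 / 2) by field.
    replace v with (1 - (1 - v)) at 2 by ring.
    apply arith_mean_le_refined_Heinz; [assumption .. |].
    (* The two excluded intervals are mirror images in [1 / 2]. *)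
    assert (hrefl : (2 ^ (n - 1) + 1) / 2 ^ n = 1 - (2 ^ (n - 1) - 1) / 2 ^ n).
    { replace (2 ^ n) with (2 * 2 ^ (n - 1))
        by (replace n with (S (n - 1)) at 2 by lia; reflexivity).
      field. apply pow_nonzero; lra. }
    rewrite hrefl. lra.
Qed.
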